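(* Let $w=w_1w_2w_3\cdots$ be a Sturmian word over the alphabet $\{a,b\}$, let $\beta_w$ be the limiting frequency of the letter $b$ in $w$, and for real $x\ge 1$ let $$M_w(x)=\sum_{1\le n\le x} D_w(n)\left(1-\frac nx\right).$$ Then, for any $\delta>0$, $$M_w(x)=\frac{\beta_w\log 2}{2}\,x+O_\delta\left(x^{\frac13+\delta}\right).$$
   Context: A Sturmian word over $\{a,b\}$ is an infinite word $w=w_1w_2w_3\cdots$ (indexed by the positive integers, with each $w_j\in\{a,b\}$) that is not ultimately periodic and has minimal complexity, i.e. for each $n\ge 0$ it contains exactly $n+1$ distinct blocks of $n$ consecutive letters. For a word $w$ over $\{a,b\}$ and an integer $n\ge 1$, define $$o_w(n)=|\{j\in\mathbb{N}: j\mid n,\ w_j=b,\ n/j\text{ odd}\}|,\qquad e_w(n)=|\{j\in\mathbb{N}: j\mid n,\ w_j=b,\ n/j\text{ even}\}|,$$ and $D_w(n)=o_w(n)-e_w(n)$. The frequency of $b$ is $$\beta_w=\lim_{n\to\infty}\frac{|\{1\le j\le n: w_j=b\}|}{n};$$ this limit is known to exist for every Sturmian word. $\log$ is the natural logarithm. The notation $O_\delta(g(x))$ denotes a quantity bounded in absolute value by $C\,g(x)$, where the constant $C$ depends only on $\delta$. *)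

(* Defs.v *)
From HB Require Import structures.
From mathcomp Require Import all_boot all_order all_algebra.
From mathcomp Require Import all_classical all_reals all_analysis.

Set Implicit Arguments.
Unset Strict Implicit.
Unset Printing Implicit Defensive.

Import Order.TTheory GRing.Theory Num.Theory.
Import numFieldNormedType.Exports.

Local Open Scope classical_set_scope.
Local Open Scope ring_scope.

Inductive letter : Type := letter_a | letter_b.

Definition bool_of_letter (l : letter) : bool :=
  if l is letter_b then true else false.

Definition letter_of_bool (c : bool) : letter :=
  if c then letter_b else letter_a.

Lemma bool_of_letterK : cancel bool_of_letter letter_of_bool.
Proof. by case. Qed.

HB.instance Definition _ := Finite.copy letter (can_type bool_of_letterK).

(* An infinite word w_1 w_2 w_3 ... is a function on nat whose value at 0 is
   irrelevant: every notion below depends only on the w j with 0 < j. *)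
Definition word : Type := nat -> letter.

Definition factor (w : word) (n j : nat) : n.-tuple letter :=
  [tuple w (j + i)%N | i < n].

Definition factors (w : word) (n : nat) : set (n.-tuple letter) :=
  factor w n @` [set j | (0 < j)%N].
Arguments factors : clear implicits.

Definition ultimately_periodic (w : word) : Prop :=
  exists N p : nat, (0 < p)%N /\ forall j, (N < j)%N -> w (j + p)%N = w j.

Definition sturmian (w : word) : Prop :=
  ~ ultimately_periodic w /\ forall n : nat, (factors w n #= `I_n.+1)%card.

Definition o_count (w : word) (n : nat) : nat :=
  count (fun j => (w j == letter_b) && odd (n %/ j)) (divisors n).

Definition e_count (w : word) (n : nat) : nat :=
  count (fun j => (w j == letter_b) && ~~ odd (n %/ j)) (divisors n).

Definition D (w : word) (n : nat) : int := (o_count w n)%:Z - (e_count w n)%:Z.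

(* The value at n = 0 is a division by zero, irrelevant for the limit. *)
Definition b_ratio (R : realType) (w : word) (n : nat) : R :=
  (count (fun j => w j == letter_b) (iota 1 n))%:R / n%:R.

Definition b_freq (R : realType) (w : word) : R :=
  limn (b_ratio R w).

Definition M (R : realType) (w : word) (x : R) : R :=
  \sum_(1 <= n < (Num.truncn x).+1) (D w n)%:~R * (1 - n%:R / x).

(* Main.v *)
(* Writing n = j k gives M_w(x) = sum_k (-1)^(k-1) H(x/k) with
   H(z) = sum_(j <= z) [w_j = b] (1 - j/z). Sturmian words are balanced, so the
   number of letters b among the first t letters is beta t + O(1); integrating,
   H(z) = beta z / 2 + E(z) where E is bounded and E(z) - E(z') = O(1 - z'/z) for
   z' <= z. The linear part contributes beta x/2 times a partial sum of the
   alternating harmonic series. In the alternating sum of E(x/k) consecutive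
   terms differ by O(1/k), so it is O(log x), which is stronger than the claim. *)

Require Import Defs.
From mathcomp Require Import all_boot all_order all_algebra.
From mathcomp Require Import all_classical all_reals all_analysis.
From mathcomp Require Import zify ring lra.

Import Order.TTheory GRing.Theory Num.Theory.
Import numFieldNormedType.Exports.

Local Open Scope ring_scope.

Local Notation factor := Defs.factor.

(** * Balance of Sturmian words *)

Lemma factorP (w : word) (n i j : nat) :
  reflect (forall k, (k < n)%N -> w (i + k)%N = w (j + k)%N)
          (factor w n i == factor w n j).
Proof.
apply: (iffP eqP) => [eqf k ltkn|eqw].
  by have /(congr1 (fun t => tnth t (Ordinal ltkn))) := eqf; rewrite !tnth_mktuple.
by apply: eq_from_tnth => k; rewrite !tnth_mktuple eqw.
Qed.

Lemma factorS (w : word) (n i : nat) :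
  factor w n.+1 i = rcons_tuple (factor w n i) (w (i + n)%N).
Proof.
have E m : factor w m i = [seq w (i + k)%N | k <- iota 0 m] :> seq _.
  by rewrite /= -val_enum_ord -map_comp.
by apply: val_inj; rewrite /= !E -addn1 iotaD map_cat cats1.
Qed.

Definition factors_before (w : word) (n : nat) (c : letter) :
    {set n.-tuple letter} :=
  [set t | `[< exists j, [/\ (0 < j)%N, factor w n j = t & w (j + n)%N = c] >]].

(** The factors as a finite set, so that cardinals of unions and differences can be computed. *)
Definition factor_set (w : word) (n : nat) : {set n.-tuple letter} :=
  [set t | t \in factors w n].

Lemma mem_factor_set (w : word) (n j : nat) :
  (0 < j)%N -> factor w n j \in factor_set w n.
Proof. by move=> j0; rewrite inE; apply/mem_set; exists j. Qed.

Lemma mem_factors_before (w : word) (n j : nat) :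
  (0 < j)%N -> factor w n j \in factors_before w n (w (j + n)%N).
Proof. by move=> j0; rewrite inE; apply/asboolP; exists j. Qed.

Lemma factors_beforeP {w n c t} : t \in factors_before w n c ->
  exists j, [/\ (0 < j)%N, factor w n j = t & w (j + n)%N = c].
Proof. by rewrite inE => /asboolP. Qed.

Lemma factor_setP {w n t} : t \in factor_set w n ->
  exists2 j, (0 < j)%N & factor w n j = t.
Proof. by rewrite inE => /set_mem[j]; exists j. Qed.

Lemma card_factor_set (w : word) (n : nat) :
  sturmian w -> #|factor_set w n| = n.+1.
Proof.
move=> [_ /(_ n) wn].
suff /card_esym/card_eq_trans/(_ wn)/card_eq_II :
  (factors w n #= `I_#|factor_set w n|)%card by [].
have inF t : factors w n t -> t \in enum (factor_set w n).
  by move=> wt; rewrite mem_enum inE; apply: mem_set.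
apply/card_set_bijP; exists (fun t => index t (enum (factor_set w n))); split.
- by move=> t /inF; rewrite -index_mem -cardE.
- by move=> t u /set_mem/inF ? /set_mem/inF ?; apply: index_inj.
- move=> i /= i_lt; pose t0 := factor w n 0.
  have ti : nth t0 (enum (factor_set w n)) i \in factor_set w n.
    by rewrite -mem_enum mem_nth// -cardE.
  exists (nth t0 (enum (factor_set w n)) i).
    by move: ti; rewrite inE => /set_mem.
  by rewrite index_uniq ?enum_uniq -?cardE.
Qed.

Definition right_special (w : word) (n : nat) : {set n.-tuple letter} :=
  factors_before w n letter_a :&: factors_before w n letter_b.

Lemma factor_setE (w : word) (n : nat) :
  factor_set w n = factors_before w n letter_a :|: factors_before w n letter_b.
Proof.
apply/finset.setP => t; apply/idP/idP => [/factor_setP[j j0 <-]|].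
  have := @mem_factors_before w n j j0.
  by rewrite finset.in_setU; case: (w _) => ->; rewrite ?orbT.
by rewrite finset.in_setU => /orP[] /factors_beforeP[j [j0 <- _]]; exact: mem_factor_set.
Qed.

Lemma factor_setS (w : word) (n : nat) :
  factor_set w n.+1 = [set rcons_tuple t letter_a | t in factors_before w n letter_a]
    :|: [set rcons_tuple t letter_b | t in factors_before w n letter_b].
Proof.
apply/finset.setP => t; apply/idP/idP => [/factor_setP[j j0 <-]|].
  have := @mem_factors_before w n j j0.
  rewrite factorS finset.in_setU.
  by case: (w _) => wj; rewrite (imset_f _ wj) ?orbT.
by rewrite finset.in_setU => /orP[] /imsetP[u /factors_beforeP[j [j0 <- wj]] ->];
  rewrite -wj -factorS mem_factor_set.
Qed.

Lemma rcons_tuple_inj (T : eqType) (n : nat) (c : T) :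
  injective (fun t : n.-tuple T => rcons_tuple t c).
Proof.
by move=> t u /(congr1 val) /= /rcons_inj[/val_inj].
Qed.

(** Every factor of length n extends to the right in one or two ways, and extensions by different
    letters are distinct. The complexity grows only from n + 1 to n + 2, so a single factor extends
    in both ways. *)
Lemma card_right_special (w : word) (n : nat) :
  sturmian w -> #|right_special w n| = 1%N.
Proof.
move=> sw; have := card_factor_set w n.+1 sw; have := card_factor_set w n sw.
rewrite factor_setS cardsU finset.disjoint_setI0 ?cards0 ?subn0; last first.
  apply/pred0P => t /=; apply/negP => /andP[/imsetP[u _ ->] /imsetP[v _]].
  by move=> /(congr1 val) /= /rcons_inj[].
rewrite !card_imset; [|exact: rcons_tuple_inj..].
have := cardsUI (factors_before w n letter_a) (factors_before w n letter_b).
rewrite -factor_setE => UI cF cS.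
have : (n.+1 + #|right_special w n| = n.+2)%N.
  exact: etrans (congr1 (addn^~ _) (esym cF)) (etrans UI cS).
by lia.
Qed.

Lemma mem_right_special (w : word) (n i j : nat) : (0 < i)%N -> (0 < j)%N ->
  factor w n i = factor w n j -> w (i + n)%N != w (j + n)%N ->
  factor w n i \in right_special w n.
Proof.
move=> i0 j0 eqij; rewrite finset.in_setI.
have := @mem_factors_before w n j j0; have := @mem_factors_before w n i i0.
by rewrite -eqij; case: (w (i + n)%N); case: (w (j + n)%N) => // -> ->.
Qed.

Lemma right_specialP (w : word) (n : nat) t : t \in right_special w n ->
  exists i j, [/\ (0 < i)%N, (0 < j)%N, factor w n i = t, factor w n j = t
                & w (i + n)%N = letter_a /\ w (j + n)%N = letter_b].
Proof.
rewrite finset.in_setI => /andP[/factors_beforeP[i [? ? ?]] /factors_beforeP[j [? ? ?]]].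
by exists i, j.
Qed.

(* A window of n + 1 starting positions sees only n non right special factors,
   so one of them repeats, and non right special factors extend uniquely. *)
Lemma right_special_window (w : word) (n i : nat) : sturmian w -> (0 < i)%N ->
  exists2 l, (l <= n)%N & factor w n (i + l) \in right_special w n.
Proof.
move=> sw i0; apply: contrapT => noRS.
have nRS l : (l <= n)%N -> factor w n (i + l) \notin right_special w n.
  by move=> ln; apply/negP => ?; apply: noRS; exists l.
have /injectivePn[l [m lm eqlm]] :
    ~~ injectiveb (fun l : 'I_n.+1 => factor w n (i + l)).
  apply/negP => /injectiveP f_inj.
  have f_card : #|[set factor w n (i + l) | l : 'I_n.+1]| = n.+1.
    by rewrite card_imset// card_ord.
  have : [set factor w n (i + l) | l : 'I_n.+1] \subset
      factor_set w n :\: right_special w n.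
    apply/fintype.subsetP => _ /imsetP[l _ ->].
    by rewrite finset.in_setD mem_factor_set ?addn_gt0 ?i0// nRS// -ltnS.
  move=> /subset_leq_card; rewrite f_card cardsD card_factor_set//.
  rewrite (finset.setIidPr _) ?card_right_special//; first by lia.
  by rewrite /right_special factor_setE; apply/fintype.subsetP => t; rewrite !inE => /andP[->].
case: sw => + _; apply.
wlog lt_lm : l m lm eqlm / (l < m)%N.
  move=> IH; have [|ml|/val_inj/eqP] := ltngtP l m; [exact: IH| |by rewrite (negPf lm)].
  by apply: (IH m l); rewrite // eq_sym.
exists (i + l)%N, (m - l)%N; split; first by lia.
have ext p q : (0 < p)%N -> (0 < q)%N -> factor w n p = factor w n q ->
    factor w n p \notin right_special w n -> factor w n p.+1 = factor w n q.+1.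
  move=> p0 q0 eqpq pRS; apply/eqP/factorP => k kn.
  have [kn1|kn1] := ltnP k.+1 n.
    by have /eqP/factorP/(_ _ kn1) := eqpq; rewrite !addnS !addSn.
  have -> : (p.+1 + k = p + n)%N by lia.
  have -> : (q.+1 + k = q + n)%N by lia.
  by apply/eqP/(contraNT _ pRS); apply: mem_right_special.
(* Equal factors that are not right special have equal successors. Past the window, the factor at
   [i + l + k.+1] repeats one found m - l positions earlier, so by induction no right special factor
   ever appears. *)
have loop k : factor w n (i + l + k) = factor w n (i + m + k) /\
    factor w n (i + l + k) \notin right_special w n.
  elim/ltn_ind: k => -[_|k IH].
    by rewrite !addn0 nRS// -ltnS.
  split.
    rewrite !addnS; have [eqk kRS] := IH k (ltnSn k).
    by apply: ext => //; lia.
  have [km|km] := leqP (l + k.+1) n; first by rewrite -addnA nRS.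
  have mn := ltn_ord m.
  have -> : (i + l + k.+1 = i + m + (l + k.+1 - m))%N by lia.
  by have [|<- //] := IH (l + k.+1 - m)%N; lia.
move=> j ij.
have -> : (j = i + l + (j - (i + l)))%N by lia.
have -> : (i + l + (j - (i + l)) + (m - l) = i + m + (j - (i + l)))%N by lia.
set k := (j - (i + l))%N.
(* Since l < m <= n, the length n is positive and the factors have a first letter to compare. *)
have [/eqP/factorP/(_ 0%N) + _] := loop k.
by rewrite !addn0 => ->//; have := ltn_ord m; lia.
Qed.

Lemma right_special_eq (w : word) (n : nat) (t u : n.-tuple letter) :
  sturmian w -> t \in right_special w n -> u \in right_special w n -> t = u.
Proof.
move=> sw; have /eqP/cards1P[v ->] := card_right_special w n sw.
by rewrite !finset.in_set1 => /eqP -> /eqP ->.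
Qed.

(* If t is a palindrome, c t c occurs in w and c' is the other letter, then the
   window starting at c t c contains no occurrence of c' t. *)
Lemma right_special_not_palindromic_extension (w : word) (m i p : nat) :
  sturmian w -> (0 < i)%N -> w (i + m.+1)%N = w i ->
  (forall k, (k < m)%N -> w (i.+1 + k)%N = w (i.+1 + (m.-1 - k))%N) ->
  w p != w i -> factor w m p.+1 = factor w m i.+1 ->
  factor w m.+1 p \notin right_special w m.+1.
Proof.
move=> sw i0 wim pal wpi /eqP/factorP eqpi; apply/negP => pRS.
have [l lm lRS] := right_special_window w m.+1 i sw i0.
have /eqP/factorP eqlp := right_special_eq _ _ _ _ sw lRS pRS.
have eql : w (i + l)%N = w p by have := eqlp 0%N isT; rewrite !addn0.
case: l => [|l] in lm lRS eqlp eql *.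
  by rewrite -eql addn0 eqxx in wpi.
move: lm; rewrite ltnS leq_eqVlt => /orP[/eqP lm|lm].
  by rewrite -eql lm wim eqxx in wpi.
(* At offset m - l, the occurrence in the window reaches the closing letter [w i]. The same offset
   from [p] falls inside t, and its mirror image there is the first letter of the window occurrence,
   which is [w p]. So [w i] and [w p] would agree. *)
have := eqlp (m - l)%N.
have -> : (i + l.+1 + (m - l) = i + m.+1)%N by lia.
have -> : (p + (m - l) = p.+1 + (m - l.+1))%N by lia.
rewrite wim eqpi; last by lia.
rewrite pal; last by lia.
have -> : (i.+1 + (m.-1 - (m - l.+1)) = i + l.+1)%N by lia.
rewrite eql => /(_ _) wi.
by rewrite wi ?eqxx// in wpi; lia.
Qed.

(** The irrelevant position 0 is counted too; it cancels because only differences of two values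
    matter. *)
Definition b_sum (w : word) (n : nat) : nat :=
  \sum_(k < n) (w k == letter_b).

Lemma b_sumS (w : word) (n : nat) :
  b_sum w n.+1 = (b_sum w n + (w n == letter_b))%N.
Proof. by rewrite /b_sum big_ord_recr. Qed.

Lemma letter_b_inj (x y : letter) : (x == letter_b) = (y == letter_b) -> x = y.
Proof. by case: x; case: y. Qed.

(* A shortest counterexample consists of factors b t b and a t a with t a
   palindrome. Then t is right special, so the right special factor one letter
   longer is a t or b t, which the occurrence of b t b or a t a excludes. *)
Lemma sturmian_balanced (w : word) (i j n : nat) :
  sturmian w -> (0 < i)%N -> (0 < j)%N ->
  (b_sum w (i + n) + b_sum w j <= b_sum w (j + n) + b_sum w i + 1)%N.
Proof.
move=> sw; elim/ltn_ind: n i j => n IH i j i0 j0.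
rewrite leqNgt; apply/negP => unbal.
case: n => [|[|m]] in IH unbal *.
- by rewrite !addn0 in unbal; lia.
- by rewrite !addn1 !b_sumS in unbal; lia.
have bal k p q : (k <= m)%N -> (0 < p)%N -> (0 < q)%N ->
    (b_sum w (p + k.+1) + b_sum w q <= b_sum w (q + k.+1) + b_sum w p + 1)%N.
  by move=> km; apply: IH; lia.
have S p : b_sum w p.+1 = (b_sum w p + (w p == letter_b))%N by exact: b_sumS.
(* The total excess is at least 2, while the prefix and the complementary suffix each have excess at
   most 1 by minimality; so every proper prefix has excess exactly 1. *)
have prefix k : (k <= m)%N ->
    (b_sum w (i + k.+1) + b_sum w j = b_sum w (j + k.+1) + b_sum w i + 1)%N.
  move=> km; have := bal k i j km i0 j0.
  have := bal (m - k)%N (i + k.+1)%N (j + k.+1)%N.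
  have -> : (i + k.+1 + (m - k).+1 = i + m.+2)%N by lia.
  have -> : (j + k.+1 + (m - k).+1 = j + m.+2)%N by lia.
  by move: unbal; lia.
have [wi wj] : w i = letter_b /\ w j = letter_a.
  have := prefix 0%N isT; rewrite !addn1 !S.
  by case: (w i); case: (w j) => //=; lia.
have [wim wjm] : w (i + m.+1)%N = letter_b /\ w (j + m.+1)%N = letter_a.
  move: unbal; have := prefix m (leqnn m); rewrite !(addnS _ m.+1) !S.
  by case: (w (i + m.+1)%N); case: (w (j + m.+1)%N) => //=; lia.
have eqt k : (k < m)%N -> w (i.+1 + k)%N = w (j.+1 + k)%N.
  move=> km; apply: letter_b_inj.
  have := prefix k (ltnW km); have := prefix k.+1 km.
  by rewrite !(addnS _ k.+1) !S !addSnnS; lia.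
have pal k : (k < m)%N -> w (i.+1 + k)%N = w (i.+1 + (m.-1 - k))%N.
  (* Balance between a prefix at [i] and the suffix of equal length at [j] gives one inequality, and
     exchanging the roles of prefix and suffix gives the other. Differencing in l then yields the
     mirror symmetry of letters. *)
  have sym l : (l <= m)%N -> (b_sum w (i + l.+1) + b_sum w (i + (m - l).+1) =
      b_sum w (i + m.+1) + b_sum w i.+1)%N.
    move=> lm; have pl := prefix l lm; have pml := prefix (m - l)%N (leq_subr _ _).
    have pm := prefix m (leqnn m).
    have := bal l i (j + (m - l).+1)%N lm i0; have := bal l (i + (m - l).+1)%N j lm.
    have -> : (i + (m - l).+1 + l.+1 = (i + m.+1).+1)%N by lia.
    have -> : (j + (m - l).+1 + l.+1 = (j + m.+1).+1)%N by lia.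
    by rewrite !S wi wjm wim /=; lia.
  move=> km; apply: letter_b_inj.
  have := sym k (ltnW km); have := sym k.+1 km.
  have -> : (i.+1 + (m.-1 - k) = i + (m - k.+1).+1)%N by lia.
  have -> : (i + (m - k).+1 = (i + (m - k.+1).+1).+1)%N by lia.
  by rewrite (addnS i k.+1) !S addSnnS; lia.
have eqij : factor w m i.+1 = factor w m j.+1 by apply/eqP/factorP.
have tRS : factor w m i.+1 \in right_special w m.
  apply: (mem_right_special _ _ _ j.+1) => //.
  by rewrite !addSnnS wim wjm.
have /set0Pn[u] : right_special w m.+1 != finset.set0.
  by rewrite -card_gt0 card_right_special.
move=> uRS; have [p [q [p0 q0 eqp eqq [wp wq]]]] := right_specialP _ _ _ uRS.
have pRS : factor w m.+1 p \in right_special w m.+1 by rewrite eqp.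
(* Deleting the first letter of a right special factor leaves a right special one, which by
   uniqueness is t. *)
have eqpi : factor w m p.+1 = factor w m i.+1.
  apply: (right_special_eq w) => //; apply: (mem_right_special _ _ _ q.+1) => //.
    apply/eqP/factorP => k km; have /eqP/factorP := etrans eqp (esym eqq).
    by rewrite !addSnnS; apply.
  by rewrite !addSnnS wp wq.
(* The factor a t is excluded by b t b at [i], and b t by a t a at [j]. *)
case wpE : (w p).
  suff /negP : factor w m.+1 p \notin right_special w m.+1 by [].
  by apply: (right_special_not_palindromic_extension w m i);
    rewrite ?wim ?wi ?wpE.
suff /negP : factor w m.+1 p \notin right_special w m.+1 by [].
apply: (right_special_not_palindromic_extension w m j);
  rewrite ?wjm ?wj ?wpE ?eqpi//.
by move=> k km; rewrite -!eqt; [exact: pal|lia..].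
Qed.

(** * Real-analytic estimates *)

(** A two-sided Fekete argument: every (s m - 1) / m lies below every (s n + 1) / n, so some b
    separates the two families, and squeezing shows that b is the limit. *)
Lemma quasi_additive_limit (R : realType) (s : nat -> R) :
  (forall m n, `|s (m + n)%N - s m - s n| <= 1) ->
  forall n, `|s n - limn (fun n => s n / n%:R) * n%:R| <= 1.
Proof.
move=> s_add.
have mult k n : `|s (k.+1 * n)%N - k.+1%:R * s n| <= k%:R.
  elim: k => [|k IH]; first by rewrite mul1n mul1r subrr normr0.
  have := s_add n (k.+1 * n)%N; rewrite -mulSn.
  by move: IH; rewrite -!natr1 !ler_norml; lra.
(* Both sides are compared with s at the product of the two indices. *)
have cross m n : (s m.+1 - 1) / m.+1%:R <= (s n.+1 + 1) / n.+1%:R.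
  rewrite ler_pdivrMr ?ltr0Sn// mulrAC ler_pdivlMr ?ltr0Sn//.
  have := mult n m.+1; have := mult m n.+1; rewrite [(m.+1 * _)%N]mulnC !ler_norml.
  have := ler0n R m; have := ler0n R n.
  by rewrite -![_.+1%:R]natr1; nra.
have [b lb ub] : exists2 b : R, forall n, (s n.+1 - 1) / n.+1%:R <= b
    & forall n, b <= (s n.+1 + 1) / n.+1%:R.
  pose E : set R := [set (s m.+1 - 1) / m.+1%:R | m in setT]%classic.
  have E0 : (E !=set0)%classic by exists ((s 1%N - 1) / 1); exists 0%N.
  have E_ub n : ubound E ((s n.+1 + 1) / n.+1%:R) by move=> _ [m _ <-].
  exists (sup E) => n; last exact: ge_sup.
  by apply: sup_upper_bound; [split=> //; exists ((s 1%N + 1) / 1); exact: (E_ub 0%N)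
    | exists n].
have near_b (n : nat) : b - n.+1%:R^-1 <= s n.+1 / n.+1%:R <= b + n.+1%:R^-1.
  have := lb n; have := ub n.
  have -> : (s n.+1 + 1) / n.+1%:R = s n.+1 / n.+1%:R + n.+1%:R^-1 by rewrite mulrDl mul1r.
  have -> : (s n.+1 - 1) / n.+1%:R = s n.+1 / n.+1%:R - n.+1%:R^-1 by rewrite mulrBl mul1r.
  by move: (n.+1%:R^-1) => u h1 h2; apply/andP; split; lra.
have -> : limn (fun n => s n / n%:R) = b.
  apply/cvg_lim => //; rewrite -(cvg_shiftS (fun n => s n / n%:R)) /=.
  have h0 := @cvg_harmonic R.
  apply: (@squeeze_cvgr _ _ _ _ (fun n => b - harmonic n) (fun n => b + harmonic n)).
  - by apply: nearW => n; exact: near_b.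
  - by rewrite -[X in (_ --> X)%classic]subr0; apply: cvgB => //; exact: cvg_cst.
  - by rewrite -[X in (_ --> X)%classic]addr0; apply: cvgD => //; exact: cvg_cst.
case=> [|n].
  by rewrite mulr0 subr0; have := s_add 0%N 0%N; rewrite subrr sub0r normrN.
have := lb n; have := ub n.
rewrite ler_pdivrMr ?ltr0Sn// ler_pdivlMr ?ltr0Sn// ler_norml; lra.
Qed.

Lemma glue_lipschitz (R : realType) (f : R -> R) (L : R) (K : nat) :
  (forall m y z, (m < K)%N -> m%:R <= y -> y <= z -> z <= m.+1%:R ->
     `|f z - f y| <= L * (z - y)) ->
  forall y z, 0 <= y -> y <= z -> z <= K%:R -> `|f z - f y| <= L * (z - y).
Proof.
elim: K => [|K IH] f_lip y z y0 yz zK.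
  have -> : z = y by lra.
  by rewrite !subrr mulr0 normr0.
have {}IH := IH (fun m y z mK => f_lip m y z (ltnW mK)).
have [zK'|Kz] := leP z K%:R; first exact: IH.
have [Ky|yK] := leP K%:R y; first by apply: (f_lip K).
have := IH y K%:R y0 (ltW yK) (lexx _).
have := f_lip K K%:R z (ltnSn K) (lexx _) (ltW Kz) zK.
rewrite -[f z - f y](subrKA (f K%:R)) => h1 h2.
by apply: (le_trans (ler_normD _ _)); lra.
Qed.

(** Consecutive terms are paired from the end, two at a time; c pays for a possible unpaired first
    term. *)
Lemma alternating_sum_le (R : realDomainType) (e d : nat -> R) (c : R) (n : nat) :
  (forall k, `|e k| <= c) -> (forall k, `|e k - e k.+1| <= d k) ->
  `|\sum_(k < n) (-1) ^+ k * e k| <= c + \sum_(k < n) d k.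
Proof.
move=> ec ed; have d0 k : 0 <= d k by apply: le_trans (ed k).
elim/ltn_ind: n => -[_|[_|n /(_ n (ltnW (ltnSn _))) IH]].
- by rewrite !big_ord0 normr0 addr0; apply: le_trans (ec 0%N).
- by rewrite !big_ord_recr !big_ord0/= !add0r expr0 mul1r; have := ec 0%N; have := d0 0%N; lra.
rewrite !big_ord_recr/= exprS mulN1r mulNr -!addrA -mulrBr.
apply: (le_trans (ler_normD _ _)); rewrite normrM normrX normrN1 expr1n mul1r.
by have := ed n; have := d0 n.+1; move: IH; lra.
Qed.

(** Both bounds are ln (1 + u) <= u, at u = -1 / (y + 1) and at u = 1 / y. *)
Lemma ln_succ_bounds (R : realType) (y : R) : 0 < y ->
  (y + 1)^-1 <= ln (y + 1) - ln y <= y^-1.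
Proof.
move=> y0; have y10 : 0 < y + 1 by lra.
apply/andP; split.
  rewrite -[_ - _]opprK lerNr opprB -ln_div ?posrE//.
  have -> : y / (y + 1) = 1 + - (y + 1)^-1 by field; rewrite gt_eqF.
  by apply: le_ln1Dx; rewrite ltrN2 invf_lt1//; lra.
rewrite -ln_div ?posrE//.
have -> : (y + 1) / y = 1 + y^-1 by field; rewrite gt_eqF.
have y'0 : 0 < y^-1 by rewrite invr_gt0.
by apply: le_ln1Dx; lra.
Qed.

Lemma harmonic_block_bounds (R : realType) (m n : nat) : (0 < m <= n)%N ->
  ln n.+1%:R - ln m.+1%:R <= \sum_(m <= k < n) (k.+1%:R^-1 : R) <= ln n%:R - ln m%:R.
Proof.
move=> /andP[m0 mn].
rewrite -(telescope_sumr (fun k => ln k%:R) mn).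
rewrite -(telescope_sumr (fun k => ln k.+1%:R) mn).
apply/andP; split; apply: ler_sum_nat => k /andP[mk _].
  by have /andP[_] := ln_succ_bounds R k.+1%:R (ltr0Sn _ _); rewrite natr1.
have k0 : 0 < k%:R :> R by rewrite ltr0n; lia.
by have /andP[+ _] := ln_succ_bounds R k%:R k0; rewrite natr1.
Qed.

Lemma harmonic_le_ln (R : realType) (n : nat) :
  \sum_(k < n) k.+2%:R^-1 <= ln n.+1%:R :> R.
Proof.
have /andP[_] := harmonic_block_bounds R 1 n.+1 isT.
by rewrite ln1 subr0 big_add1 big_mkord.
Qed.

(** Catalan's identity. Passing to n + 1, the block gains 1 / (2n + 1) and 1 / (2n + 2) and loses 1
    / (n + 1) = 2 / (2n + 2). *)
Lemma alternating_harmonic_double (R : realType) (n : nat) :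
  \sum_(k < n.*2) (-1) ^+ k / k.+1%:R = \sum_(n <= k < n.*2) k.+1%:R^-1 :> R.
Proof.
elim: n => [|n IH]; first by rewrite big_ord0 big_geq.
rewrite doubleS !big_ord_recr /= IH exprS -signr_odd odd_double expr0.
rewrite [in RHS]big_nat_recr /=; last by lia.
have [->|n0] := posnP n; first by rewrite !big_geq//= double0; lra.
rewrite [in RHS]big_nat_recr /=; last by lia.
rewrite [in LHS]big_ltn; last by lia.
have -> : n.*2.+2%:R^-1 = n.+1%:R^-1 / 2 :> R.
  by rewrite -doubleS -muln2 natrM invfM.
by move: (n.+1%:R^-1) (n.*2.+1%:R^-1) => u v; field.
Qed.

Lemma alternating_harmonic_bound (R : realType) (n : nat) : (0 < n)%N ->
  `|\sum_(k < n) (-1) ^+ k / k.+1%:R - ln 2| <= n%:R^-1 :> R.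
Proof.
(* Even partial sums lie below ln 2 by at most the next term 1 / (2m + 1); adding that term handles
   the odd ones. *)
have even m : - m.*2.+1%:R^-1 <= \sum_(k < m.*2) (-1) ^+ k / k.+1%:R - ln (2 : R) <= 0.
  rewrite alternating_harmonic_double.
  case: m => [|m].
    have ln2_ge0 : 0 <= ln 2 :> R by rewrite ln_ge0// ler1n.
    have ln2_le1 : ln 2 <= 1 :> R by apply: (@le_ln1Dx R 1); lra.
    by rewrite big_geq// double0 invr1; apply/andP; split; lra.
  have := harmonic_block_bounds R m.+1 m.+1.*2.
  have -> : ln m.+1.*2%:R = ln m.+1%:R + ln 2 :> R.
    by rewrite -muln2 natrM lnM ?posrE.
  have -> : ln m.+2%:R = ln m.+1.*2.+2%:R - ln 2 :> R.
    by rewrite -doubleS -muln2 natrM lnM ?posrE// addrK.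
  have := ln_succ_bounds R m.+1.*2.+1%:R (ltr0Sn _ _); rewrite natr1.
  move=> /andP[_ h] /(_ _)/andP[]; first by lia.
  by move: h; move: (m.+1.*2.+1%:R^-1) => u; lra.
move=> n0; rewrite -[n]odd_double_half.
have := even n./2; case nE : (odd n) => /=.
  rewrite add1n big_ord_recr/= -signr_odd odd_double mul1r.
  have : 0 < n./2.*2.+1%:R^-1 :> R by rewrite invr_gt0.
  by rewrite ler_norml; move: (n./2.*2.+1%:R^-1) => u; lra.
rewrite add0n ler_norml => /andP[h1 h2]; apply/andP; split; last first.
  by apply: (le_trans h2); rewrite invr_ge0.
apply: le_trans h1; rewrite lerN2 lef_pV2 ?posrE ?ler_nat ?ltr0n//.
by rewrite -[n]odd_double_half nE in n0; lia.
Qed.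

(** * The weighted sum *)

Definition b_indicator (R : realType) (w : word) (j : nat) : R :=
  (w j == letter_b)%:R.

Lemma b_indicator_sumE (R : realType) (w : word) (n : nat) :
  \sum_(1 <= j < n.+1) b_indicator R w j =
  (count (fun j => w j == letter_b) (iota 1 n))%:R.
Proof.
rewrite -sum1_count natr_sum [in RHS]big_mkcond /index_iota subn1 /=.
by apply: eq_bigr => j _; rewrite /b_indicator; case: eqP.
Qed.

(** Balance between the first m letters and the m letters after position n makes the count of b
    quasi-additive with error 1. *)
Lemma b_freq_discrepancy (R : realType) (w : word) : sturmian w ->
  forall n, `|\sum_(1 <= j < n.+1) b_indicator R w j - b_freq R w * n%:R| <= 1.
Proof.
move=> sw n; rewrite b_indicator_sumE.
apply: (@quasi_additive_limit R
  (fun n => (count (fun j => w j == letter_b) (iota 1 n))%:R)) => {}n m.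
have E k : b_sum w k.+1 =
    (count (fun j => w j == letter_b) (iota 1 k) + b_sum w 1)%N.
  elim: k => [//|k IH]; rewrite b_sumS IH -[in RHS](addn1 k) iotaD count_cat /=.
  by rewrite addn0 add1n addnAC.
have := sturmian_balanced w n.+1 1 m sw isT isT.
have := sturmian_balanced w 1 n.+1 m sw isT isT.
rewrite !add1n !addSn (E n) (E m) (E (n + m)%N); move: (b_sum w 1) => b1 h2 h1.
rewrite ler_norml; move: (count _ (iota 1 (n + m))) h2 h1 => c h2 h1.
move: (count _ (iota 1 n)) (count _ (iota 1 m)) h2 h1 => a b h2 h1.
have {}h1 : (c <= a + b + 1)%N by lia.
have {}h2 : (a + b <= c + 1)%N by lia.
by move: h1 h2; rewrite -!(ler_nat R) !natrD; lra.
Qed.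

Lemma b_freq_bounds (R : realType) (w : word) : sturmian w ->
  `|b_freq R w| <= 2.
Proof.
move=> /(@b_freq_discrepancy R)/(_ 1%N); rewrite big_nat1 mulr1 /b_indicator.
by case: (_ == _); rewrite !ler_norml /=; lra.
Qed.

(* [ramp_sum c N z] is the integral over [0, z] of the summatory function of c,
   as long as z <= N + 1. *)
Definition ramp_sum (R : realType) (c : nat -> R) (N : nat) (z : R) : R :=
  \sum_(1 <= j < N.+1) c j * Num.max (z - j%:R) 0.

(** On [m, m + 1] the ramp sum has constant slope s, the m-th partial sum of c, and the secant slope
    of the difference is s - b (y + z) / 2. This is at most |s - b m| + |b| <= 1 + 2. *)
Lemma ramp_sum_lipschitz (R : realType) (c : nat -> R) (b : R) (N : nat) :
  (forall n, `|\sum_(1 <= j < n.+1) c j - b * n%:R| <= 1) -> `|b| <= 2 ->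
  forall y z, 0 <= y -> y <= z -> z <= N.+1%:R ->
  `|(ramp_sum R c N z - b / 2 * z ^+ 2) - (ramp_sum R c N y - b / 2 * y ^+ 2)|
    <= 3 * (z - y).
Proof.
move=> cb b2; apply: (glue_lipschitz R (fun z => ramp_sum R c N z - b / 2 * z ^+ 2)).
move=> m y z mN my yz zm.
have -> : ramp_sum R c N z = ramp_sum R c N y + \sum_(1 <= j < m.+1) c j * (z - y).
  rewrite /ramp_sum (big_cat_nat (n := m.+1))//= [in RHS](big_cat_nat (n := m.+1))//=.
  rewrite addrAC -big_split /=; congr (_ + _); apply: eq_big_nat => j /andP[j1 jm].
    have jy : j%:R <= y by apply: le_trans my; rewrite ler_nat.
    by rewrite !max_l ?subr_ge0//; [ring|lra].
  have jz : z <= j%:R by apply: (le_trans zm); rewrite ler_nat.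
  by rewrite !max_r ?subr_le0//; lra.
have := cb m; rewrite -mulr_suml; set s := \sum_(_ <= _ < _) _ => sm.
have -> : ramp_sum R c N y + s * (z - y) - b / 2 * z ^+ 2 -
    (ramp_sum R c N y - b / 2 * y ^+ 2) =
    ((s - b * m%:R) - b * ((z + y) / 2 - m%:R)) * (z - y) by field.
rewrite normrM [`|z - y|]ger0_norm; last by lra.
rewrite ler_wpM2r//; first by lra.
apply: (le_trans (ler_normB _ _)); rewrite normrM.
have : `|(z + y) / 2 - m%:R| <= 1 by rewrite ler_norml; move: zm; rewrite -natr1; lra.
move: sm b2; have := normr_ge0 b; nra.
Qed.

(** Here [k.+1] is the codivisor n / j, so the sign is + exactly when n / j is odd. The ranges of j
    and k do not depend on n, which permits exchanging them with a sum over n. *)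
Lemma D_sumE (R : realType) (w : word) (N n : nat) : (0 < n <= N)%N ->
  (D w n)%:~R = \sum_(1 <= j < N.+1) \sum_(0 <= k < N)
     (if (j * k.+1 == n)%N then b_indicator R w j * (-1) ^+ k else 0).
Proof.
move=> /andP[n0 nN].
have DE s : (count (fun j => (w j == letter_b) && odd (n %/ j)) s)%:Z -
    (count (fun j => (w j == letter_b) && ~~ odd (n %/ j)) s)%:Z =
    \sum_(j <- s) (w j == letter_b)%:R * (-1) ^+ (~~ odd (n %/ j)).
  elim: s => [|j s IH]; first by rewrite big_nil subrr.
  rewrite big_cons -IH /= !PoszD.
  by case: (w j == letter_b); case: odd; rewrite /= ?expr0 ?expr1; lia.
rewrite /D DE rmorph_sum /=.
have -> : \sum_(j <- divisors n) ((w j == letter_b)%:R * (-1) ^+ (~~ odd (n %/ j)) : int)%:~R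
  = \sum_(j <- [seq j <- index_iota 1 N.+1 | (j %| n)%N])
      ((w j == letter_b)%:R * (-1) ^+ (~~ odd (n %/ j)) : int)%:~R :> R.
  apply: perm_big; apply: uniq_perm.
  - exact: divisors_uniq.
  - by rewrite filter_uniq// iota_uniq.
  move=> j; rewrite -dvdn_divisors// mem_filter mem_index_iota.
  case: (boolP (j %| n)%N) => //= jn.
  by have := dvdn_leq n0 jn; have := dvdn_gt0 n0 jn; lia.
rewrite big_filter big_mkcond; apply: eq_big_nat => j /andP[j0 jN].
case: ifP => jn; last first.
  rewrite big1 // => k _; case: eqP => // nE.
  by rewrite -nE dvdn_mulr in jn.
have [q nE] : exists q, n = (j * q.+1)%N.
  by case/dvdnP: jn => -[|q] nE; [rewrite nE in n0|exists q; rewrite mulnC].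
rewrite [in RHS](eq_bigr (fun k => if k == q then b_indicator R w j * (-1) ^+ k else 0)).
  rewrite -big_mkcond big_nat1_eq /= ifT; last first.
    by apply: leq_trans nN; rewrite nE leq_pmull.
  by rewrite nE mulKn// oddS negbK signr_odd rmorphM rmorphXn rmorphN1 rmorph_nat.
by move=> k _; rewrite nE eqn_pmul2l.
Qed.

(** With n = j (k + 1), the weight 1 - n / x equals (k + 1) / x times x / (k + 1) - j, and the
    maximum with 0 in [ramp_sum] encodes n <= x. *)
Lemma M_alternating_sum (R : realType) (w : word) (x : R) : 1 <= x ->
  M w x = \sum_(0 <= k < Num.truncn x) (-1) ^+ k *
     (k.+1%:R / x * ramp_sum R (b_indicator R w) (Num.truncn x) (x / k.+1%:R)).
Proof.
move=> x1; rewrite /M; set N := Num.truncn x.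
have x0 : 0 < x by lra.
transitivity (\sum_(1 <= n < N.+1) \sum_(1 <= j < N.+1) \sum_(0 <= k < N)
    (if (n == j * k.+1)%N then b_indicator R w j * (-1) ^+ k * (1 - n%:R / x) else 0)).
  apply: eq_big_nat => n /andP[n0 nN]; rewrite (@D_sumE R w N) ?n0//.
  rewrite mulr_suml; apply: eq_bigr => j _; rewrite mulr_suml; apply: eq_bigr => k _.
  by rewrite eq_sym; case: ifP => _; rewrite ?mul0r.
rewrite exchange_big /=; under eq_bigr do rewrite exchange_big /=.
rewrite exchange_big /=; apply: eq_bigr => k _.
rewrite /ramp_sum !mulr_sumr; apply: eq_big_nat => j /andP[j0 jN].
rewrite -big_mkcond big_nat1_eq.
have k0 : 0 < k.+1%:R :> R by rewrite ltr0Sn.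
rewrite muln_gt0 j0 /= ltnS truncn_ge_nat; last by lra.
have -> : x / k.+1%:R - j%:R = (x - (j * k.+1)%:R) / k.+1%:R.
  by rewrite natrM; field; rewrite gt_eqF.
case: ifP => jx; last first.
  rewrite max_r ?mulr0// pmulr_lle0 ?invr_gt0// subr_le0.
  by move/negbT: jx; rewrite -ltNge => /ltW.
rewrite max_l; last by rewrite divr_ge0// subr_ge0.
by field; rewrite gt_eqF// gt_eqF.
Qed.

(** The difference of slopes is (f z - f y) / z minus (f y / y) (1 - y / z), and each piece is at
    most L (1 - y / z). *)
Lemma lipschitz_slope_variation (R : realFieldType) (f : R -> R) (L K : R) :
  f 0 = 0 ->
  (forall y z, 0 <= y -> y <= z -> z <= K -> `|f z - f y| <= L * (z - y)) ->
  forall y z, 0 < y -> y <= z -> z <= K ->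
  `|f z / z| <= L /\ `|f z / z - f y / y| <= 2 * L * (1 - y / z).
Proof.
move=> f0 f_lip y z y0 yz zK; have z0 : 0 < z by lra.
have fle u : 0 < u -> u <= K -> `|f u| <= L * u.
  by move=> u0 uK; have := f_lip 0 u (lexx _) (ltW u0) uK; rewrite f0 !subr0.
split; first by rewrite normrM normfV (gtr0_norm z0) ler_pdivrMr// fle.
have -> : f z / z - f y / y = (f z - f y) / z - f y / y * (1 - y / z).
  by field; rewrite !gt_eqF.
have yz1 : 0 <= 1 - y / z by rewrite subr_ge0 ler_pdivrMr// mul1r.
have -> : 2 * L * (1 - y / z) = L * (1 - y / z) + L * (1 - y / z) by ring.
apply: (le_trans (ler_normB _ _)); apply: lerD.
  rewrite normrM normfV (gtr0_norm z0).
  have -> : L * (1 - y / z) = L * (z - y) / z by field; rewrite gt_eqF.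
  by rewrite ler_wpM2r ?invr_ge0 ?(ltW z0)// f_lip// ltW.
rewrite !normrM normfV (gtr0_norm y0) (ger0_norm yz1) ler_wpM2r//.
by rewrite ler_pdivrMr// fle//; lra.
Qed.

Lemma ln_le_powR_third (R : realType) (x : R) : 1 <= x ->
  ln x <= 3 * x `^ (1 / 3).
Proof.
move=> x1; have y0 : 0 < x `^ (1 / 3) by rewrite powR_gt0; lra.
have := ln_sublinear y0; rewrite ln_powR; lra.
Qed.

(** The alternating error sum costs 3 + 6 ln (N + 1), where 3 is the Lipschitz constant and 6 its
    double; truncating the alternating harmonic series costs the remaining 2. *)
Lemma M_log_bound (R : realType) (w : word) (x : R) : sturmian w -> 1 <= x ->
  `|M w x - b_freq R w * ln 2 / 2 * x| <= 5 + 6 * ln (2 * x).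
Proof.
move=> sw x1; set b := b_freq R w; set N := Num.truncn x.
have x0 : 0 < x by lra.
have N1 : (0 < N)%N by rewrite truncn_ge_nat//; lra.
have /andP[Nx xN] : N%:R <= x < N.+1%:R by apply: truncn_itv; lra.
pose Phi z := ramp_sum R (b_indicator R w) N z - b / 2 * z ^+ 2.
have Phi0 : Phi 0 = 0.
  rewrite /Phi /ramp_sum expr0n mulr0 subr0 big1 // => j _.
  by rewrite max_r ?mulr0// sub0r oppr_le0.
have b2 : `|b| <= 2 by exact: b_freq_bounds.
have Phi_lip := ramp_sum_lipschitz R _ b N (b_freq_discrepancy R w sw) b2.
have slope := lipschitz_slope_variation R Phi 3 N.+1%:R Phi0 Phi_lip.
(* The error E of H at x / (k + 1). As x may exceed N, the Lipschitz bound is taken up to N + 1. *)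
pose e k := Phi (x / k.+1%:R) / (x / k.+1%:R).
have itv k : [/\ 0 < x / k.+2%:R, x / k.+2%:R <= x / k.+1%:R & x / k.+1%:R <= N.+1%:R].
  split; first by rewrite divr_gt0.
    by rewrite ler_wpM2l ?(ltW x0)// lef_pV2 ?posrE// ler_nat.
  apply: le_trans (ltW xN); rewrite ler_pdivrMr// ler_peMr ?(ltW x0)//.
  by rewrite ler1n.
have e_le k : `|e k| <= 3.
  by have [h1 h2 h3] := itv k; have [] := slope _ _ h1 h2 h3.
have e_var k : `|e k - e k.+1| <= 6 * k.+2%:R^-1.
  have [h1 h2 h3] := itv k; have [_] := slope _ _ h1 h2 h3.
  have -> : 1 - x / k.+2%:R / (x / k.+1%:R) = k.+2%:R^-1.
    have k0 : 0 < k.+1%:R :> R by [].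
    rewrite -[k.+2%:R]natr1; move: k.+1%:R k0 => y y0.
    have y10 : 0 < y + 1 by lra.
    by field; rewrite !gt_eqF.
  have -> : 2 * 3 = 6 :> R by ring.
  by [].
have -> : M w x - b * ln 2 / 2 * x = \sum_(k < N) (-1) ^+ k * e k +
    b / 2 * x * (\sum_(k < N) (-1) ^+ k / k.+1%:R - ln 2).
  rewrite M_alternating_sum// big_mkord -/N.
  have -> : \sum_(k < N) (-1) ^+ k *
     (k.+1%:R / x * ramp_sum R (b_indicator R w) N (x / k.+1%:R)) =
     \sum_(k < N) ((-1) ^+ k * e k + b / 2 * x * ((-1) ^+ k / k.+1%:R)).
    apply: eq_bigr => k _; rewrite /e /Phi.
    by move: (ramp_sum _ _ _ _) => g; field; rewrite !gt_eqF.
  by rewrite big_split /= -mulr_sumr; field.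
have osc := alternating_sum_le R e _ 3 N e_le e_var.
have har := harmonic_le_ln R N; have alt := alternating_harmonic_bound R N N1.
rewrite -mulr_sumr in osc.
have lnN : ln N.+1%:R <= ln (2 * x).
  rewrite ler_ln ?posrE//; last by lra.
  by rewrite -natr1; lra.
apply: (le_trans (ler_normD _ _)).
have main : `|b / 2 * x * (\sum_(k < N) (-1) ^+ k / k.+1%:R - ln 2)| <= 2.
  have N0 : 0 < N%:R :> R by rewrite ltr0n.
  rewrite normrM normrM (gtr0_norm x0).
  (* From |b| <= 2 and x < N + 1 <= 2N; the factor N cancels the 1 / N of the harmonic tail. *)
  have bx : `|b / 2| * x <= 2 * N%:R.
    have N1R : 1 <= N%:R :> R by rewrite ler1n.
    rewrite normrM (gtr0_norm (x := 2^-1)) ?invr_gt0//.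
    by move: xN; rewrite -natr1; have := normr_ge0 b; nra.
  apply: (le_trans (ler_pM _ _ bx alt)); rewrite ?mulr_ge0 ?(ltW x0)//.
  by rewrite mulfK// gt_eqF.
lra.
Qed.

Theorem theorem1 (R : realType) (delta : R) (hdelta : 0 < delta) :
  exists C : R, forall w : word, sturmian w -> forall x : R, 1 <= x ->
    `|M w x - b_freq R w * ln 2 / 2 * x| <= C * x `^ (1 / 3 + delta).
Proof.
(* 5 + 6 ln 2 + 6 ln x is at most 5 + 6 + 18 x^(1/3), and 5 + 6 + 18 = 29. *)
exists 29 => w sw x x1; apply: (le_trans (M_log_bound R w x sw x1)).
have pow : x `^ (1 / 3) <= x `^ (1 / 3 + delta) by rewrite ler_powR//; lra.
have pow1 : 1 <= x `^ (1 / 3) by rewrite -[leLHS](powRr0 x) ler_powR//; lra.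
have lnx := ln_le_powR_third R x x1.
have ln2 : ln 2 <= 1 :> R by apply: (@le_ln1Dx R 1); lra.
rewrite lnM ?posrE//; last by lra.
lra.
Qed.
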